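(* Let $n\in\mathbb{N}$, let $f(z)=\sum_{m=0}^\infty f_mz^m$ be analytic in the disc $|z|<\rho$ ($\rho>0$), and let $a>0$, $p>0$. Then for $|z|<\rho/a$ the following extrapolation formula holds: $$f(az)=\sum_{k=1}^n\mu_kf(\lambda_kz)-p f_{n-1}z^{n-1}+r_n(z),\qquad |r_n(z)|\le\sum_{m=2n}^\infty|f_m|\,|az|^m,$$ where the frequencies $\lambda_1,\dots,\lambda_n$ are the pairwise distinct roots of the polynomial $$\check G_n(\lambda)=\check g_n\left(\lambda^n-\frac{a^{2n-1}}{na^{n-1}+p}\sum_{m=0}^{n-1}\frac{\lambda^m}{a^m}\right),\qquad \check g_n=(-1)^{n(n+1)/2}p^{n-1}\left(na^{n-1}+p\right)\ne0,$$ and $$|\lambda_kz|<\delta a|z|<a|z|,\qquad \delta=\left(1+\frac{p}{na^{n-1}}\right)^{-1/n}.$$ The amplitudes $\mu_k$ are uniquely determined by $$\mu_k=\frac{\check g_n}{\check G_n'(\lambda_k)}\sum_{m=1}^{n}(-1)^{n-m}\sigma^{(k)}_{n-m}\,s_{m-1},\qquad k=1,\dots,n.$$ Moreover, $\lambda_k=\lambda_k(a,p,n)$ and $\mu_k=\mu_k(a,p,n)$, so they are independent of the function $f$ and universal in this sense. The extrapolation formula is exact for the polynomials of degree $2n-1$, i.e. $r_n(z)\equiv0$ for the polynomials $f$ such that $\deg f\le2n-1$.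
   Context: The numbers $s_m$ are the moments $s_m=a^m$ for $0\le m\le 2n-1$, $m\ne n-1$, and $s_{n-1}=a^{n-1}+p$. For $k=1,\dots,n$, $\sigma_j^{(k)}$ denotes the elementary symmetric polynomial of degree $j$ in the numbers $\lambda_1,\dots,\lambda_{k-1},0,\lambda_{k+1},\dots,\lambda_n$, with $\sigma_0^{(k)}=1$. The formula for $\mu_k$ is the solution of the linear (Vandermonde) system $\sum_{k=1}^n\mu_k\lambda_k^m=s_m$, $m=0,\dots,n-1$.
   Formalization: The chain |λ_k z| < δa|z| < a|z| is stated for z ≠ 0 only (at z = 0 all terms are 0), and for n = 1 its first inequality is ≤ instead of <, since then λ_1 = a/(1+p) = δa gives equality. *)

(* Defs.v *)
From HB Require Import structures.
From mathcomp Require Import all_boot all_order all_algebra complex.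
From mathcomp Require Import all_classical all_reals all_analysis.

Set Implicit Arguments.
Unset Strict Implicit.
Unset Printing Implicit Defensive.

Import Order.TTheory GRing.Theory Num.Theory.
Import numFieldNormedType.Exports.

Local Open Scope classical_set_scope.
Local Open Scope complex_scope.
Local Open Scope ring_scope.

(* Real-valued modulus; the generic norm on R[i] takes its values in R[i]. *)
Notation cmod := ComplexField.Normc.normc.

(* [f] is analytic in the disc |z| < rho, with Taylor coefficients [c] at 0.
   The regular module R[i]^o is what carries the topology of R[i]. *)
Definition analytic_in_disc (R : realType) (rho : R) (f : R[i] -> R[i])
    (c : nat -> R[i]) : Prop :=
  forall z : R[i], cmod z < rho ->
    series (fun m => c m * z ^+ m : R[i]^o) @ \oo --> (f z : R[i]^o).

Definition moment (R : realType) (n : nat) (a p : R) (m : nat) : R :=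
  if m == n.-1 then a ^+ n.-1 + p else a ^+ m.

Definition gcheck (R : realType) (n : nat) (a p : R) : R :=
  (-1) ^+ (n * n.+1 %/ 2) * p ^+ n.-1 * (n%:R * a ^+ n.-1 + p).

Definition Gcheck (R : realType) (n : nat) (a p : R) : {poly R} :=
  gcheck n a p *:
    ('X^n - (a ^+ (2 * n).-1 / (n%:R * a ^+ n.-1 + p))
              *: \sum_(m < n) a ^- m *: 'X^m).

Definition GcheckC (R : realType) (n : nat) (a p : R) : {poly R[i]} :=
  map_poly (real_complex R) (Gcheck n a p).

(* [lam] lists all the roots of [P], repeated according to multiplicity. *)
Definition root_list (R : realType) (n : nat) (P : {poly R[i]})
    (lam : 'I_n -> R[i]) : Prop :=
  P = lead_coef P *: \prod_(k < n) ('X - (lam k)%:P).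

Definition delta (R : realType) (n : nat) (a p : R) : R :=
  (1 + p / (n%:R * a ^+ n.-1)) `^ (- n%:R^-1).

Definition elem_sym (R : realType) (n : nat) (x : 'I_n -> R[i]) (j : nat)
    : R[i] :=
  \sum_(A : {set 'I_n} | #|A| == j) \prod_(i in A) x i.

Definition sigma (R : realType) (n : nat) (lam : 'I_n -> R[i]) (k : 'I_n)
    (j : nat) : R[i] :=
  elem_sym (fun i => if i == k then 0 else lam i) j.

Definition amplitude (R : realType) (n : nat) (a p : R) (lam : 'I_n -> R[i])
    (k : 'I_n) : R[i] :=
  (gcheck n a p)%:C / (GcheckC n a p)^`().[lam k]
    * \sum_(1 <= m < n.+1)
        (-1) ^+ (n - m) * sigma lam k (n - m) * (moment n a p m.-1)%:C.

(* The r_n(z) defined by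
   f(az) = sum_k mu_k f(lam_k z) - p f_{n-1} z^{n-1} + r_n(z). *)
Definition remainder (R : realType) (n : nat) (a p : R)
    (lam mu : 'I_n -> R[i]) (f : R[i] -> R[i]) (c : nat -> R[i]) (z : R[i])
    : R[i] :=
  f (a%:C * z)
    - (\sum_(k < n) mu k * f (lam k * z) - p%:C * c n.-1 * z ^+ n.-1).

(* Main.v *)
Require Import Defs.
From HB Require Import structures.
From mathcomp Require Import all_boot all_order all_algebra complex.
From mathcomp Require Import all_classical all_reals all_analysis.
From mathcomp Require Import zify ring lra.

Set Implicit Arguments.
Unset Strict Implicit.
Unset Printing Implicit Defensive.

Import Order.TTheory GRing.Theory Num.Theory.
Import numFieldNormedType.Exports.

Local Open Scope classical_set_scope.
Local Open Scope complex_scope.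
Local Open Scope ring_scope.

(* Put y_k = lam_k / a, q = p / a^(n-1) and c = 1 / (n + q). Then the y_k are the
   roots of y^n = c (1 + y + ... + y^(n-1)); since n c < 1, taking moduli gives
   |y| < 1 and then |y|^n <= n c = delta^n. The normalised power sums
   u_m = sum_k mu_k y_k^m satisfy u_(n+j) = c (u_j + ... + u_(n+j-1)). The
   amplitudes are the Vandermonde solution with u_m = 1 for m < n - 1 and
   u_(n-1) = 1 + q. Each window u_j, ..., u_(n+j-1) with j < n contains u_(n-1)
   exactly once, whence u_n = ... = u_(2n-1) = 1: this is the exactness for
   degrees at most 2n - 1. From then on u_m lies in [0, 1] because n c < 1, so
   the coefficients 1 - u_m of the remainder are also in [0, 1]. *)

(** * Vieta's formulas and Lagrange interpolation *)

(** Expand the product over the sets A of indices at which -x_i is chosen instead of X; such a set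
    feeds the power n - #|A|. This links the sums [sigma] to polynomial coefficients. *)
Lemma coef_prod_XsubC (R : realType) (n : nat) (x : 'I_n -> R[i]) (j : nat) :
  (j <= n)%N ->
  (\prod_(i < n) ('X - (x i)%:P))`_j = (-1) ^+ (n - j) * elem_sym x (n - j).
Proof.
move=> le_jn.
under eq_bigr do rewrite addrC.
rewrite bigA_distr coef_sum /elem_sym big_distrr /= [RHS]big_mkcond /=.
apply: eq_bigr => A _.
rewrite big_if /= prodrN -rmorph_prod /= prodr_const.
have cardA : (#|A| + #|[predC A]| = n)%N by rewrite cardC card_ord.
have -> : #|(fun i : 'I_n => i \notin A)| = #|[predC A]| by [].
have -> : (-1) ^+ #|A| = ((-1) ^+ #|A|)%:P :> {poly R[i]}.
  by rewrite rmorphXn rmorphN1.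
rewrite -polyCM coefCM coefXn.
have -> : (j == #|[predC A]|) = (#|A| == n - j)%N by apply/eqP/eqP; lia.
by case: eqP => [->|_]; rewrite ?mulr1 ?mulr0.
Qed.

(** The L_k are unnormalised Lagrange polynomials at the nodes x_k. Let S be the linear functional
    sending X^m to s_m for m < n. If nu represents S, applying it to L_k leaves only the node x_k.
    Conversely, X^m equals its own Lagrange interpolant, so nu_k = S(L_k) / L_k(x_k) reproduces
    s_m. *)
Lemma moments_interpolation (F : fieldType) (n : nat) (x : 'I_n -> F)
    (s : nat -> F) (nu : 'I_n -> F)
    (L := fun k : 'I_n => \prod_(i < n | i != k) ('X - (x i)%:P) : {poly F}) :
  injective x ->
  (forall m, (m < n)%N -> \sum_(k < n) nu k * x k ^+ m = s m)
  <-> (forall k, nu k = (L k).[x k]^-1 * \sum_(m < n) (L k)`_m * s m).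
Proof.
move=> x_inj.
have sizeL k : (size (L k) <= n)%N.
  have : size (L k * ('X - (x k)%:P)) = n.+1.
    rewrite /L mulrC -(bigD1 k (P := predT) (F := fun i => 'X - (x i)%:P)) //=.
    by rewrite -[index_enum _]enumT size_prod_XsubC -cardE card_ord.
  have L_neq0 : L k != 0 by apply/prodf_neq0 => i _; rewrite polyXsubC_eq0.
  by rewrite size_mul ?polyXsubC_eq0// size_XsubC addn2 /= => -[->].
have Lkk k : (L k).[x k] != 0.
  rewrite horner_prod; apply/prodf_neq0 => i neq_ik.
  by rewrite hornerXsubC subr_eq0 (inj_eq x_inj) eq_sym.
have Lkj k j : j != k -> (L k).[x j] = 0.
  move=> neq_jk; rewrite horner_prod; apply/eqP/prodf_eq0; exists j => //.
  by rewrite hornerXsubC subrr.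
split=> [nuE k|nuE m lt_mn].
  under eq_bigr => m _ do rewrite -nuE// mulr_sumr.
  rewrite exchange_big /=.
  have colE j : \sum_(m < n) (L k)`_m * (nu j * x j ^+ m) = nu j * (L k).[x j].
    rewrite (horner_coef_wide _ (sizeL k)) mulr_sumr.
    by apply: eq_bigr => m _; rewrite mulrCA.
  under eq_bigr do rewrite colE.
  rewrite (bigD1 k) //= big1 => [|j neq_jk]; last by rewrite Lkj ?mulr0.
  by rewrite addr0 mulrCA mulVf ?mulr1.
(* The Lagrange interpolant of X^m minus X^m: its degree is below n and it vanishes at n distinct
   nodes, so it is zero. *)
pose d := \sum_(k < n) (x k ^+ m / (L k).[x k]) *: L k - 'X^m.
have size_d : (size d <= n)%N.
  rewrite (leq_trans (size_polyD _ _))// geq_max size_polyN size_polyXn lt_mn.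
  rewrite andbT; apply: (leq_trans (size_sum _ _ _)); apply/bigmax_leqP => k _.
  by rewrite (leq_trans (size_scale_leq _ _)).
have root_d j : d.[x j] = 0.
  rewrite hornerD hornerN hornerXn horner_sum (bigD1 j) //= hornerZ divfK//.
  rewrite big1 ?addr0 ?subrr// => k neq_kj.
  by rewrite hornerZ (Lkj k j) ?mulr0// eq_sym.
have d0 : d = 0.
  apply: (@roots_geq_poly_eq0 _ d (codom x)).
  - by apply/allP => _ /codomP[j ->]; rewrite rootE root_d.
  - by rewrite map_inj_uniq ?enum_uniq.
  - by rewrite size_codom card_ord.
have coef_d (i : 'I_n) :
    \sum_(k < n) x k ^+ m / (L k).[x k] * (L k)`_i = (i == m :> nat)%:R.
  have := congr1 (fun q : {poly F} => q`_i) d0.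
  rewrite coef0 coefB coef_sum coefXn => /subr0_eq <-.
  by apply: eq_bigr => k _; rewrite coefZ.
transitivity (\sum_(k < n) \sum_(i < n) (x k ^+ m / (L k).[x k] * (L k)`_i) * s i).
  apply: eq_bigr => k _; rewrite nuE mulrC mulrA mulr_sumr.
  by apply: eq_bigr => i _; rewrite mulrA.
rewrite exchange_big /=; under eq_bigr => i _ do rewrite -mulr_suml coef_d.
by rewrite (bigD1 (Ordinal lt_mn)) //= eqxx mul1r big1 ?addr0// => i;
  rewrite -val_eqE /= => /negbTE ->; rewrite mul0r.
Qed.

Lemma horner_deriv_prod (F : fieldType) (n : nat) (x : 'I_n -> F) (k : 'I_n) :
  (\prod_(i < n) ('X - (x i)%:P))^`().[x k]
  = (\prod_(i < n | i != k) ('X - (x i)%:P)).[x k].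
Proof.
rewrite (bigD1 k) //= derivM derivXsubC mul1r hornerD hornerM !hornerE.
by rewrite subrr mul0r addr0.
Qed.

(** * Simplicity of the scaled roots *)

(** Formally, differentiate (y - 1) (1 + ... + y^(n-1)) = y^n - 1 and multiply by y. *)
Lemma scaled_geom_deriv (A : comRingType) (y : A) (n : nat) :
  (y - 1) * \sum_(m < n) m%:R * y ^+ m
  = n%:R * y ^+ n - y * \sum_(m < n) y ^+ m.
Proof.
elim: n => [|n IHn]; first by rewrite !big_ord0; ring.
rewrite !big_ord_recr /= !mulrDr IHn exprS -natr1; ring.
Qed.

(* The last two hypotheses say that y is a double root of y^n - c sum_(m<n) y^m.
   Multiplying by y - 1 forces y = n(1+c)/(n+1) > 0, while combining them gives
   sum_(m<n) (n-m) y^m = 0. *)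
Lemma no_double_root (R : realType) (n : nat) (c : R) (y : R[i]) :
  (0 < n)%N -> 0 < c -> y ^+ n = c%:C * \sum_(m < n) y ^+ m ->
  n%:R * y ^+ n = c%:C * \sum_(m < n) m%:R * y ^+ m -> False.
Proof.
move=> n_gt0 c_gt0 y_root y_droot.
have c_neq0 : c%:C != 0 :> R[i] by rewrite fmorph_eq0 gt_eqF.
have y_neq0 : y != 0.
  apply/eqP => y0; move: y_root; rewrite y0 expr0n gtn_eqF// => /esym/eqP.
  rewrite mulf_eq0 (negbTE c_neq0) /= -(prednK n_gt0) big_ord_recl /= expr0.
  by rewrite big1 ?addr0 ?oner_eq0// => i _; rewrite expr0n.
have n1_neq0 : n.+1%:R != 0 :> R[i] by rewrite pnatr_eq0.
have y_real : y = (n%:R * (1 + c) / n.+1%:R)%:C.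
  have yn_neq0 : y ^+ n != 0 by rewrite expf_neq0.
  have : (y - 1) * (n%:R * y ^+ n) = y ^+ n * (c%:C * n%:R - y).
    rewrite y_droot mulrCA scaled_geom_deriv mulrBr [_ * (y * _)]mulrCA -y_root.
    ring.
  rewrite mulrA [LHS]mulrC => /(mulfI yn_neq0) yE.
  rewrite fmorph_div rmorphM rmorphD rmorph1 !rmorph_nat.
  apply: (canRL (mulfK n1_neq0)); rewrite -natr1 mulrDr mulr1.
  by rewrite -[y * n%:R](subrK n%:R) -[X in _ - X + _]mul1r -mulrBl yE; ring.
have r_gt0 : 0 < n%:R * (1 + c) / n.+1%:R.
  by rewrite divr_gt0 ?mulr_gt0 ?ltr0n ?addr_gt0.
set r := n%:R * _ / _ in y_real r_gt0.
have : \sum_(m < n) (n - m)%:R * r ^+ m = 0.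
  apply: (@fmorph_inj _ _ (real_complex R)); apply: (mulfI c_neq0).
  rewrite raddf0 mulr0 rmorph_sum /=.
  under eq_bigr => m _ do
    rewrite rmorphM rmorphXn /= -y_real (natrB _ (ltnW (ltn_ord m)))
            rmorphB !rmorph_nat mulrBl.
  rewrite big_split /= sumrN mulrBr -mulr_sumr -y_droot mulrCA -y_root.
  by rewrite subrr.
apply/eqP; rewrite gt_eqF// (bigD1 (Ordinal n_gt0)) //= expr0 mulr1 subn0.
rewrite ltr_pwDl ?ltr0n// sumr_ge0// => m _.
by rewrite mulr_ge0// exprn_ge0// ltW.
Qed.

(** * Moduli of the scaled roots *)

Lemma sum_ord_le (R : numDomainType) (n : nat) (f : 'I_n -> R) (M : R) :
  (forall i, f i <= M) -> \sum_(i < n) f i <= n%:R * M.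
Proof.
move=> f_le; have : \sum_(i < n) f i <= \sum_(i < n) M by apply: ler_sum.
by rewrite sumr_const card_ord mulr_natl.
Qed.

(** If r >= 1, every r^m with m < n is at most r^n, so r^n <= n c r^n < r^n. Hence r < 1 and the sum
    is at most n. For n = 1 the sum is the single term 1, which leaves only the weak inequality. *)
Lemma root_modulus (R : realFieldType) (n : nat) (c r : R) :
  (0 < n)%N -> 0 < c -> n%:R * c < 1 -> 0 <= r ->
  r ^+ n <= c * \sum_(m < n) r ^+ m ->
  if n == 1%N then r ^+ n <= n%:R * c else r ^+ n < n%:R * c.
Proof.
move=> n_gt0 c_gt0 nc_lt1 r_ge0 r_root.
have r_lt1 : r < 1.
  rewrite ltNge; apply/negP => r_ge1.
  have : c * \sum_(m < n) r ^+ m <= n%:R * c * r ^+ n.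
    rewrite [leRHS]mulrAC [leRHS]mulrC ler_wpM2l ?(ltW c_gt0)//.
    by apply: sum_ord_le => m; rewrite ler_weXn2l// ltnW.
  move=> /(le_trans r_root); apply/negP; rewrite -ltNge.
  by rewrite gtr_pMl// exprn_gt0// (lt_le_trans ltr01).
case: n n_gt0 nc_lt1 r_root => // -[|n] _ _ r_root.
  by apply: le_trans r_root _; rewrite big_ord1 expr0 mulr1 mul1r.
apply: le_lt_trans r_root _; rewrite mulrC ltr_pM2r//.
(* The term of exponent 1 is r < 1; it alone makes the comparison with n strict. *)
rewrite !big_ord_recl /= expr0 expr1 -nat1r -nat1r ltrD2l ltr_leD//.
rewrite -[leRHS]mulr1; apply: sum_ord_le => m.
by rewrite exprn_ile1// ltW.
Qed.

(** Brings [delta] to the form n c with c = 1 / (n + q), the bound that [root_modulus] gives for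
    r^n. *)
Lemma delta_expn (R : realType) (n : nat) (a p : R) :
  (0 < n)%N -> 0 < a -> 0 < p ->
  delta n a p ^+ n = n%:R * (n%:R + p / a ^+ n.-1)^-1.
Proof.
move=> n_gt0 a_gt0 p_gt0.
have n_neq0 : n%:R != 0 :> R by rewrite pnatr_eq0 -lt0n.
have a_neq0 : a ^+ n.-1 != 0 by rewrite expf_neq0 ?gt_eqF.
have na_gt0 : 0 < n%:R * a ^+ n.-1 by rewrite mulr_gt0 ?exprn_gt0 ?ltr0n.
rewrite /delta -powR_mulrn ?powR_ge0// -powRrM mulNr mulVf// powR_inv1; last first.
  by rewrite addr_ge0// divr_ge0// ltW.
have -> : n%:R + p / a ^+ n.-1 = n%:R * (1 + p / (n%:R * a ^+ n.-1)).
  by field; rewrite n_neq0 a_neq0.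
by rewrite [(_ * (1 + _))^-1]invfM mulrA mulfV// mul1r.
Qed.

(** * The recurrence of the normalised power sums *)

Lemma moments_extend (F : fieldType) (n : nat) (q : F) (u : nat -> F) :
  (0 < n)%N -> n%:R + q != 0 ->
  (forall j, u (n + j)%N = (n%:R + q)^-1 * \sum_(m < n) u (m + j)%N) ->
  (forall m, (m < n)%N -> u m = 1 + q *+ (m == n.-1)) ->
  forall m, (m < 2 * n)%N -> u m = 1 + q *+ (m == n.-1).
Proof.
move=> n_gt0 nq_neq0 u_rec u_init; elim/ltn_ind => m IHm lt_m2n.
have [/u_init //|le_nm] := ltnP m n.
have -> : (m == n.-1) = false by lia.
rewrite addr0 -(subnKC le_nm) u_rec; set j := (m - n)%N.
have uE (i : 'I_n) : u (i + j)%N = 1 + q *+ (i + j == n.-1)%N.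
  by apply: IHm; have := ltn_ord i; lia.
under eq_bigr do rewrite uE.
(* Position of the exceptional index n - 1 in the window starting at j; it exists because m < 2n
   gives j < n. The window thus sums to n + q, which cancels the factor in front. *)
have lt_kn : (n.-1 - j < n)%N by lia.
rewrite big_split /= sumr_const card_ord (bigD1 (Ordinal lt_kn)) //=.
rewrite subnK ?eqxx; last lia.
rewrite big1 ?addr0 ?mulVf// => i; rewrite -val_eqE /= => neq_i.
by have -> : (i + j == n.-1)%N = false by lia.
Qed.

(** For m >= 2n the window before m starts at m - n >= n, so it avoids the index n - 1 and all its
    entries lie in [0, 1] by induction; their sum times c is at most n c <= 1. The real witness also
    records that these complex numbers are real. *)
Lemma moments_bounded (R : realType) (n : nat) (c : R) (u : nat -> R[i]) :
  0 <= c -> n%:R * c <= 1 ->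
  (forall j, u (n + j)%N = c%:C * \sum_(m < n) u (m + j)%N) ->
  (forall m, (n <= m < 2 * n)%N -> u m = 1) ->
  forall m, (n <= m)%N -> exists2 v : R, 0 <= v <= 1 & u m = v%:C.
Proof.
move=> c_ge0 nc_le1 u_rec u_init; elim/ltn_ind => m IHm le_nm.
have [lt_m2n|le_2nm] := ltnP m (2 * n).
  by exists 1; rewrite ?ler01 ?lexx// u_init ?le_nm// rmorph1.
have /choice[v vP] (i : 'I_n) :
    exists v : R, 0 <= v <= 1 /\ u (i + (m - n))%N = v%:C.
  have := ltn_ord i => lt_in.
  by have [||v] := IHm (i + (m - n))%N; [lia|lia|exists v].
exists (c * \sum_i v i).
  have -> /= : 0 <= c * \sum_i v i.
    by rewrite mulr_ge0 ?sumr_ge0// => i _; have [/andP[]] := vP i.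
  apply: le_trans nc_le1; rewrite mulrC ler_wpM2r//.
  by rewrite -[leRHS]mulr1; apply: sum_ord_le => i; have [/andP[]] := vP i.
rewrite -(subnKC le_nm) u_rec rmorphM rmorph_sum /=; congr (_ * _).
by apply: eq_bigr => i _; have [_ ->] := vP i.
Qed.

(** * The real-valued modulus on [R[i]] *)

Lemma cmod_ge0 (R : realType) (x : R[i]) : 0 <= cmod x.
Proof. by rewrite -lecR; apply: (normr_ge0 x). Qed.

Lemma cmodX (R : realType) (x : R[i]) (m : nat) : cmod (x ^+ m) = cmod x ^+ m.
Proof.
elim: m => [|m IHm]; first exact: ComplexField.Normc.normc1.
by rewrite !exprS ComplexField.Normc.normcM IHm.
Qed.

Lemma cmod_real (R : realType) (x : R) : cmod x%:C = `|x|.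
Proof. by rewrite /= expr0n addr0 sqrtr_sqr. Qed.

(** [Rcomplex R] is [R[i]] with [cmod] as its real-valued norm, so the general triangle inequality
    applies. *)
Lemma cmod_sum_le (R : realType) (I : Type) (r : seq I) (P : pred I)
    (F : I -> R[i]) :
  cmod (\sum_(i <- r | P i) F i) <= \sum_(i <- r | P i) cmod (F i).
Proof. exact: (@ler_norm_sum _ (Rcomplex R)). Qed.

(** Some u_N bounded by M lies within e of l, so [cmod l] is at most M + e for every real e > 0.
    Distances in [R[i]^o] are [R[i]]-valued, whence the embedding of e. *)
Lemma cmod_lim_le (R : realType) (u : nat -> R[i]^o) (l : R[i]^o) (M : R) :
  u @ \oo --> l -> (\forall N \near \oo, cmod (u N) <= M) -> cmod l <= M.
Proof.
move=> /cvgrPdist_lt u_l u_M; apply/ler_addgt0Pr => e e_gt0.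
have /u_l u_e : 0 < e%:C by rewrite ltcR.
have [N [uN_M uN_e]] : exists N, cmod (u N) <= M /\ `|l - u N| < e%:C.
  by have [N _ /(_ N (leqnn N))] := filterI u_M u_e; exists N.
rewrite -(subrK (u N) l) addrC (le_trans (le_normcD _ _))// lerD//.
by rewrite ltW// -ltcR.
Qed.

(** * The polynomial [GcheckC] and its roots *)

Lemma gcheck_neq0 (R : realType) (n : nat) (a p : R) :
  (0 < n)%N -> 0 < a -> 0 < p -> gcheck n a p != 0.
Proof.
move=> n_gt0 a_gt0 p_gt0; have na_gt0 : 0 < n%:R * a ^+ n.-1 + p.
  by rewrite addr_gt0 ?mulr_gt0 ?exprn_gt0 ?ltr0n.
by rewrite /gcheck !mulf_neq0 ?signr_eq0 ?expf_neq0 ?gt_eqF.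
Qed.

(** Cancelling a^(n-1) turns a^(2n-1) / (n a^(n-1) + p) into a^n / (n + q) with q = p / a^(n-1),
    which prepares the scaling lambda = a y. *)
Lemma GcheckCE (R : realType) (n : nat) (a p : R) :
  (0 < n)%N -> 0 < a -> 0 < p ->
  GcheckC n a p = (gcheck n a p)%:C *: ('X^n - \sum_(m < n)
    ((n%:R + p / a ^+ n.-1)^-1%:C * a%:C ^+ n / a%:C ^+ m) *: 'X^m).
Proof.
move=> n_gt0 a_gt0 p_gt0; rewrite /GcheckC /Gcheck map_polyZ; congr (_ *: _).
rewrite rmorphB /= map_polyXn; congr (_ - _).
rewrite map_polyZ rmorph_sum scaler_sumr; apply: eq_bigr => m _.
rewrite /= map_polyZ /= map_polyXn scalerA; congr (_ *: _).
rewrite -!rmorphXn -fmorphV -!rmorphM; congr (_%:C).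
have -> : (2 * n).-1 = (n + n.-1)%N by lia.
have A_gt0 : 0 < a ^+ n.-1 by rewrite exprn_gt0.
have nA_gt0 : 0 < n%:R * a ^+ n.-1 + p by rewrite addr_gt0 ?mulr_gt0 ?ltr0n.
rewrite exprD; congr (_ * _); field.
by rewrite !gt_eqF.
Qed.

Lemma horner_GcheckC (R : realType) (n : nat) (a p : R) (y : R[i]) :
  (0 < n)%N -> 0 < a -> 0 < p ->
  (GcheckC n a p).[a%:C * y] = (gcheck n a p)%:C * a%:C ^+ n *
    (y ^+ n - (n%:R + p / a ^+ n.-1)^-1%:C * \sum_(m < n) y ^+ m).
Proof.
move=> n_gt0 a_gt0 p_gt0; have a_neq0 : a%:C != 0 by rewrite fmorph_eq0 gt_eqF.
rewrite GcheckCE// hornerZ -mulrA; congr (_ * _).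
rewrite hornerD hornerN hornerXn horner_sum mulrBr exprMn mulrCA !mulr_sumr.
congr (_ - _).
apply: eq_bigr => m _; rewrite hornerZ hornerXn exprMn.
by rewrite [LHS]mulrA [RHS]mulrA divfK ?expf_neq0.
Qed.

(** The extra factor a y turns the derivative of each X^m into m times the m-th power, which gives
    the second equation of [no_double_root]. *)
Lemma horner_deriv_GcheckC (R : realType) (n : nat) (a p : R) (y : R[i]) :
  (0 < n)%N -> 0 < a -> 0 < p ->
  (GcheckC n a p)^`().[a%:C * y] * (a%:C * y)
  = (gcheck n a p)%:C * a%:C ^+ n * (n%:R * y ^+ n
      - (n%:R + p / a ^+ n.-1)^-1%:C * \sum_(m < n) m%:R * y ^+ m).
Proof.
move=> n_gt0 a_gt0 p_gt0; have a_neq0 : a%:C != 0 by rewrite fmorph_eq0 gt_eqF.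
have derivXnM m (x : R[i]) : ('X^m)^`().[x] * x = m%:R * x ^+ m.
  by rewrite derivXn hornerMn hornerXn; case: m => [|m];
    rewrite ?mul0r// mulrnAl -exprSr mulr_natl.
rewrite GcheckCE// derivZ hornerZ -!mulrA; congr (_ * _).
rewrite derivB hornerD hornerN raddf_sum /= horner_sum mulrBl derivXnM.
rewrite mulrBr exprMn mulrCA mulr_suml !mulr_sumr; congr (_ - _).
apply: eq_bigr => m _; rewrite derivZ hornerZ -[LHS]mulrA derivXnM exprMn.
by rewrite [m%:R * (_ * _)]mulrCA [LHS]mulrA divfK ?expf_neq0//; ring.
Qed.

Lemma size_lead_GcheckC (R : realType) (n : nat) (a p : R) :
  (0 < n)%N -> 0 < a -> 0 < p ->
  size (GcheckC n a p) = n.+1 /\ lead_coef (GcheckC n a p) = (gcheck n a p)%:C.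
Proof.
move=> n_gt0 a_gt0 p_gt0.
have g_neq0 : (gcheck n a p)%:C != 0 by rewrite fmorph_eq0 gcheck_neq0.
rewrite GcheckCE// size_scale// lead_coefZ.
set S := \sum_(m < n) _.
have size_S : (size (- S) < size ('X^n : {poly R[i]}))%N.
  rewrite size_polyN size_polyXn ltnS; apply: (leq_trans (size_sum _ _ _)).
  apply/bigmax_leqP => m _; rewrite (leq_trans (size_scale_leq _ _))//.
  by rewrite size_polyXn.
by rewrite size_polyDl// lead_coefDl// size_polyXn lead_coefXn mulr1.
Qed.

Lemma GcheckC_roots_exist (R : realType) (n : nat) (a p : R) :
  (0 < n)%N -> 0 < a -> 0 < p ->
  exists lam : 'I_n -> R[i], root_list (GcheckC n a p) lam.
Proof.
move=> n_gt0 a_gt0 p_gt0.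
have [sizeG _] := size_lead_GcheckC n_gt0 a_gt0 p_gt0.
have [r rE] := closed_field_poly_normal (GcheckC n a p).
have size_r : size r = n.
  have lead_neq0 : lead_coef (GcheckC n a p) != 0.
    by rewrite lead_coef_eq0 -size_poly_eq0 sizeG.
  by move: sizeG; rewrite {1}rE size_scale// size_prod_XsubC => -[].
exists (fun k => r`_k); rewrite /root_list {1}rE; congr (_ *: _).
by rewrite (big_nth 0) size_r big_mkord.
Qed.

Lemma GcheckC_scaled_root (R : realType) (n : nat) (a p : R)
    (lam : 'I_n -> R[i]) (k : 'I_n) (y := lam k / a%:C) :
  (0 < n)%N -> 0 < a -> 0 < p -> root_list (GcheckC n a p) lam ->
  y ^+ n = (n%:R + p / a ^+ n.-1)^-1%:C * \sum_(m < n) y ^+ m.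
Proof.
move=> n_gt0 a_gt0 p_gt0 lamP.
have a_neq0 : a%:C != 0 by rewrite fmorph_eq0 gt_eqF.
have g_neq0 : (gcheck n a p)%:C != 0 by rewrite fmorph_eq0 gcheck_neq0.
apply/eqP; rewrite -subr_eq0; apply/eqP.
apply: (mulfI (mulf_neq0 g_neq0 (expf_neq0 n a_neq0))).
rewrite -horner_GcheckC// mulr0 /y mulrC divfK// lamP hornerZ horner_prod.
by rewrite (bigD1 k) //= hornerXsubC subrr mul0r mulr0.
Qed.

(** Serves twice: a repeated root makes the product vanish, and [gcheck] cancels in the
    amplitudes. *)
Lemma deriv_GcheckC_root (R : realType) (n : nat) (a p : R)
    (lam : 'I_n -> R[i]) (k : 'I_n) :
  (0 < n)%N -> 0 < a -> 0 < p -> root_list (GcheckC n a p) lam ->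
  (GcheckC n a p)^`().[lam k] = (gcheck n a p)%:C
    * (\prod_(i < n | i != k) ('X - (lam i)%:P)).[lam k].
Proof.
move=> n_gt0 a_gt0 p_gt0 lamP.
have [_ leadG] := size_lead_GcheckC n_gt0 a_gt0 p_gt0.
by rewrite lamP leadG derivZ hornerZ horner_deriv_prod.
Qed.

(** If lambda_i = lambda_j with i != j, the derivative at lambda_i contains the zero factor lambda_i
    - lambda_j; the scaled root is then double, contrary to [no_double_root]. *)
Lemma GcheckC_roots_inj (R : realType) (n : nat) (a p : R)
    (lam : 'I_n -> R[i]) :
  (0 < n)%N -> 0 < a -> 0 < p -> root_list (GcheckC n a p) lam ->
  injective lam.
Proof.
move=> n_gt0 a_gt0 p_gt0 lamP i j lam_ij; apply/eqP/negPn/negP => neq_ij.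
have a_neq0 : a%:C != 0 by rewrite fmorph_eq0 gt_eqF.
have g_neq0 : (gcheck n a p)%:C != 0 by rewrite fmorph_eq0 gcheck_neq0.
have c_gt0 : 0 < (n%:R + p / a ^+ n.-1)^-1.
  by rewrite invr_gt0 addr_gt0 ?ltr0n ?divr_gt0 ?exprn_gt0.
apply: (no_double_root n_gt0 c_gt0 (GcheckC_scaled_root i n_gt0 a_gt0 p_gt0 lamP)).
apply/eqP; rewrite -subr_eq0; apply/eqP.
apply: (mulfI (mulf_neq0 g_neq0 (expf_neq0 n a_neq0))).
rewrite -horner_deriv_GcheckC// mulr0 [a%:C * _]mulrC divfK//.
rewrite (deriv_GcheckC_root i n_gt0 a_gt0 p_gt0 lamP) horner_prod.
by rewrite (bigD1 j) ?[j == i]eq_sym//= hornerXsubC lam_ij subrr mul0r mulr0 mul0r.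
Qed.

(** The triangle inequality applied to the equation of the scaled root gives the hypothesis of
    [root_modulus]. For n = 1 the only root a / (1 + p) equals delta a, so strictness is claimed
    only for the other n. *)
Lemma GcheckC_root_bound (R : realType) (n : nat) (a p : R)
    (lam : 'I_n -> R[i]) (k : 'I_n) :
  (0 < n)%N -> 0 < a -> 0 < p -> root_list (GcheckC n a p) lam ->
  (if n == 1%N then cmod (lam k) <= delta n a p * a
   else cmod (lam k) < delta n a p * a) /\ delta n a p < 1.
Proof.
move=> n_gt0 a_gt0 p_gt0 lamP.
have c_gt0 : 0 < (n%:R + p / a ^+ n.-1)^-1.
  by rewrite invr_gt0 addr_gt0 ?ltr0n ?divr_gt0 ?exprn_gt0.
have deltaE := delta_expn n_gt0 a_gt0 p_gt0.
have delta_ge0 : 0 <= delta n a p by apply: powR_ge0.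
have := GcheckC_scaled_root k n_gt0 a_gt0 p_gt0 lamP.
set c := (_)^-1 in c_gt0 deltaE *; set y := lam k / _ => y_root.
have nc_lt1 : n%:R * c < 1.
  by rewrite ltr_pdivrMr ?mul1r ?ltrDl ?divr_gt0 ?exprn_gt0// -invr_gt0.
split; last by rewrite -(expr_lt1 n_gt0)// deltaE.
have lamE : cmod (lam k) = cmod y * a.
  rewrite -(divfK _ (lam k) : lam k / a%:C * a%:C = lam k); last first.
    by rewrite fmorph_eq0 gt_eqF.
  by rewrite ComplexField.Normc.normcM /= expr0n addr0 sqrtr_sqr gtr0_norm.
have r_ge0 : 0 <= cmod y by rewrite -lecR; apply: (normr_ge0 y).
have r_root : cmod y ^+ n <= c * \sum_(m < n) cmod y ^+ m.
  (* The generic norm of y is [cmod y] embedded in [R[i]], so the inequality is proved there. *)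
  rewrite -lecR rmorphM rmorph_sum !rmorphXn /=.
  rewrite -[(cmod y)%:C]/`|y| -normrX y_root normrM ger0_norm ?lecR ?(ltW c_gt0)//.
  rewrite ler_wpM2l ?lecR ?(ltW c_gt0)//; apply: le_trans (ler_norm_sum _ _ _) _.
  by apply: ler_sum => m _; rewrite normrX rmorphXn.
have := root_modulus n_gt0 c_gt0 nc_lt1 r_ge0 r_root.
rewrite -deltaE lamE; case: ifP => _.
  by rewrite ler_pXn2r// ler_pM2r.
by rewrite ltr_pXn2r ?gtn_eqF// ltr_pM2r.
Qed.

(** * The amplitudes and their power sums *)

(** Replacing lambda_k by 0 turns the full product into X L, so by Vieta the sigma term of index m +
    1 is the coefficient of X^m in L. This accounts for the shifted moment index in [amplitude]. *)
Lemma amplitudeE (R : realType) (n : nat) (a p : R)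
    (lam : 'I_n -> R[i]) (k : 'I_n)
    (L := \prod_(i < n | i != k) ('X - (lam i)%:P) : {poly R[i]}) :
  (0 < n)%N -> 0 < a -> 0 < p -> root_list (GcheckC n a p) lam ->
  amplitude a p lam k = L.[lam k]^-1 * \sum_(m < n) L`_m * (moment n a p m)%:C.
Proof.
move=> n_gt0 a_gt0 p_gt0 lamP.
have g_neq0 : (gcheck n a p)%:C != 0 by rewrite fmorph_eq0 gcheck_neq0.
rewrite /amplitude deriv_GcheckC_root// invfM mulrA mulfV// mul1r.
rewrite big_add1 /= big_mkord; congr (_ * _); apply: eq_bigr => m _.
congr (_ * _); rewrite /sigma -coef_prod_XsubC//.
rewrite (bigD1 k) //= eqxx subr0 mulrC coefMX /=.
by rewrite (eq_bigr (fun i => 'X - (lam i)%:P)) // => i /negbTE ->.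
Qed.

Lemma amplitude_moments (R : realType) (n : nat) (a p : R)
    (lam nu : 'I_n -> R[i]) :
  (0 < n)%N -> 0 < a -> 0 < p -> root_list (GcheckC n a p) lam ->
  (forall m : nat, (m < n)%N ->
     \sum_(k < n) nu k * lam k ^+ m = (moment n a p m)%:C)
  <-> (forall k : 'I_n, nu k = amplitude a p lam k).
Proof.
move=> n_gt0 a_gt0 p_gt0 lamP.
have lam_inj := GcheckC_roots_inj n_gt0 a_gt0 p_gt0 lamP.
apply: (iff_trans (moments_interpolation _ _ lam_inj)).
by split=> nuE k; rewrite nuE amplitudeE.
Qed.

Lemma amplitude_quadrature (R : realType) (n : nat) (a p : R)
    (lam : 'I_n -> R[i]) (t := fun m : nat =>
      \sum_(k < n) amplitude a p lam k * lam k ^+ m) :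
  (0 < n)%N -> 0 < a -> 0 < p -> root_list (GcheckC n a p) lam ->
  (forall m : nat, (m < 2 * n)%N -> t m = (moment n a p m)%:C) /\
  (forall m : nat, (n <= m)%N ->
     exists2 v : R, 0 <= v <= 1 & t m = a%:C ^+ m * v%:C).
Proof.
move=> n_gt0 a_gt0 p_gt0 lamP.
have a_neq0 : a%:C != 0 by rewrite fmorph_eq0 gt_eqF.
pose q := p / a ^+ n.-1; have q_gt0 : 0 < q by rewrite divr_gt0 ?exprn_gt0.
have nq_gt0 : 0 < n%:R + q by rewrite addr_gt0 ?ltr0n.
pose u m := \sum_(k < n) amplitude a p lam k * (lam k / a%:C) ^+ m.
have tE m : t m = a%:C ^+ m * u m.
  rewrite mulr_sumr; apply: eq_bigr => k _.
  by rewrite mulrCA -exprMn [a%:C * _]mulrC divfK.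
have momentE m : (moment n a p m)%:C = a%:C ^+ m * (1 + q%:C *+ (m == n.-1)).
  rewrite -rmorphXn -rmorphMn -(rmorph1 (real_complex R)) -rmorphD -rmorphM.
  congr (_%:C); rewrite /moment; case: eqP => [->|_]; last by rewrite addr0 mulr1.
  by rewrite mulrDr mulr1 /q mulr1n mulrC divfK// expf_neq0// gt_eqF.
(* Multiply the equation of each scaled root by its j-th power and sum against the amplitudes. *)
have u_rec j : u (n + j)%N = (n%:R + q)^-1%:C * \sum_(m < n) u (m + j)%N.
  rewrite exchange_big mulr_sumr /=; apply: eq_bigr => k _.
  rewrite exprD (GcheckC_scaled_root k n_gt0 a_gt0 p_gt0 lamP) mulrCA -mulrA.
  rewrite mulr_suml; congr (_ * _); apply: eq_bigr => m _.
  by rewrite exprD mulrCA.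
have u_init m : (m < n)%N -> u m = 1 + q%:C *+ (m == n.-1).
  move=> lt_mn; apply: (mulfI (expf_neq0 m a_neq0)); rewrite -tE -momentE.
  exact: (amplitude_moments _ n_gt0 a_gt0 p_gt0 lamP).2.
have u_2n m : (m < 2 * n)%N -> u m = 1 + q%:C *+ (m == n.-1).
  move: m; apply: moments_extend => //.
    by rewrite -(rmorph_nat (real_complex R)) -rmorphD fmorph_eq0 gt_eqF.
  by move=> j; rewrite u_rec fmorphV rmorphD rmorph_nat.
split=> [m lt_m2n|m le_nm]; first by rewrite tE u_2n.
have [|||v v01 uE] := moments_bounded _ _ u_rec _ le_nm.
- by rewrite invr_ge0 ltW.
- by rewrite ler_pdivrMr// mul1r lerDl ltW.
- move=> i /andP[le_ni lt_i2n]; rewrite u_2n//.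
  by have -> : (i == n.-1) = false; [lia | rewrite addr0].
by exists v; rewrite // tE uE.
Qed.

(** * The remainder: truncation, limit and bound *)

(* Truncating the Taylor series at N >= 2n, the correction term
   p c_(n-1) z^(n-1) cancels the only defective moment. *)
Lemma remainder_partial (R : realType) (n : nat) (a p : R)
    (lam mu : 'I_n -> R[i]) (c : nat -> R[i]) (z : R[i]) (N : nat)
    (t := fun m : nat => \sum_(k < n) mu k * lam k ^+ m) :
  (0 < n)%N -> (2 * n <= N)%N ->
  (forall m : nat, (m < 2 * n)%N -> t m = (moment n a p m)%:C) ->
  \sum_(0 <= m < N) c m * (a%:C * z) ^+ m
    - (\sum_(k < n) mu k * (\sum_(0 <= m < N) c m * (lam k * z) ^+ m)
       - p%:C * c n.-1 * z ^+ n.-1)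
  = \sum_(2 * n <= m < N) c m * z ^+ m * (a%:C ^+ m - t m).
Proof.
move=> n_gt0 le_2nN t_moment.
have -> : \sum_(k < n) mu k * (\sum_(0 <= m < N) c m * (lam k * z) ^+ m)
    = \sum_(0 <= m < N) c m * z ^+ m * t m.
  under eq_bigr do rewrite mulr_sumr.
  rewrite exchange_big /=; apply: eq_bigr => m _; rewrite mulr_sumr.
  by apply: eq_bigr => k _; rewrite exprMn; ring.
rewrite opprB addrCA -sumrB.
rewrite (eq_bigr (fun m => c m * z ^+ m * (a%:C ^+ m - t m))); last first.
  by move=> m _; rewrite exprMn; ring.
rewrite (big_cat_nat _ le_2nN)//= addrA.
have lt_n1 : (n.-1 < 2 * n)%N by lia.
rewrite [X in _ + X + _](_ : _ = - (p%:C * c n.-1 * z ^+ n.-1)); last first.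
  rewrite big_mkord (bigD1 (Ordinal lt_n1)) //= t_moment// /moment eqxx.
  rewrite big1 ?addr0 => [|m]; first by rewrite rmorphD rmorphXn /=; ring.
  rewrite -val_eqE /= => /negbTE m_neq; rewrite t_moment// /moment m_neq.
  by rewrite rmorphXn subrr mulr0.
by rewrite subrr add0r.
Qed.

(** Truncation at N = 2n is exact for such q, and the sum left by [remainder_partial] is then
    empty. *)
Lemma remainder_poly (R : realType) (n : nat) (a p : R)
    (lam mu : 'I_n -> R[i]) (q : {poly R[i]}) (z : R[i]) :
  (0 < n)%N -> (size q <= 2 * n)%N ->
  (forall m : nat, (m < 2 * n)%N ->
     \sum_(k < n) mu k * lam k ^+ m = (moment n a p m)%:C) ->
  remainder a p lam mu (fun x => q.[x]) (fun m => q`_m) z = 0.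
Proof.
move=> n_gt0 size_q t_moment.
have qE x : q.[x] = \sum_(0 <= m < 2 * n) q`_m * x ^+ m.
  by rewrite (horner_coef_wide _ size_q) big_mkord.
rewrite /remainder qE; under [X in _ - (X - _)]eq_bigr do rewrite qE.
by rewrite remainder_partial// big_geq.
Qed.

(** A finite linear combination of convergent Taylor series, plus a correction term constant in
    N. *)
Lemma remainder_cvg (R : realType) (n : nat) (a p rho : R)
    (lam mu : 'I_n -> R[i]) (f : R[i] -> R[i]) (c : nat -> R[i]) (z : R[i]) :
  analytic_in_disc rho f c -> cmod (a%:C * z) < rho ->
  (forall k, cmod (lam k * z) < rho) ->
  (fun N => \sum_(0 <= m < N) c m * (a%:C * z) ^+ m
    - (\sum_(k < n) mu k * (\sum_(0 <= m < N) c m * (lam k * z) ^+ m)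
       - p%:C * c n.-1 * z ^+ n.-1) : R[i]^o) @ \oo
    --> (remainder a p lam mu f c z : R[i]^o).
Proof.
move=> f_an az_lt lamz_lt.
apply: cvgB; first exact: f_an.
apply: cvgB; last exact: cvg_cst.
apply: cvg_big => [|k _]; last by apply: cvgMl_tmp; exact: f_an.
exact: add_continuous.
Qed.

(** For m >= 2n the defect a^m - t_m equals a^m (1 - v) with v in [0, 1], so each term is dominated
    by |c_m| |a z|^m; the bound passes from the truncations to their limit. *)
Lemma remainder_le (R : realType) (n : nat) (a p rho : R)
    (lam mu : 'I_n -> R[i]) (f : R[i] -> R[i]) (c : nat -> R[i]) (z : R[i]) :
  (0 < n)%N -> analytic_in_disc rho f c -> cmod (a%:C * z) < rho ->
  (forall k, cmod (lam k * z) < rho) ->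
  (forall m : nat, (m < 2 * n)%N ->
     \sum_(k < n) mu k * lam k ^+ m = (moment n a p m)%:C) ->
  (forall m : nat, (n <= m)%N ->
     exists2 v : R, 0 <= v <= 1 &
       \sum_(k < n) mu k * lam k ^+ m = a%:C ^+ m * v%:C) ->
  ((cmod (remainder a p lam mu f c z))%:E
    <= \sum_(2 * n <= m <oo) (cmod (c m) * cmod (a%:C * z) ^+ m)%:E)%E.
Proof.
move=> n_gt0 f_an az_lt lamz_lt t_moment t_le.
set S := (\sum_(_ <= _ <oo) _)%E.
have partial_le N : (2 * n <= N)%N ->
    ((\sum_(2 * n <= m < N) cmod (c m) * cmod (a%:C * z) ^+ m)%:E <= S)%E.
  move=> _; rewrite -sumEFin; apply: nneseries_lim_ge => m _ _.
  by rewrite lee_fin mulr_ge0 ?exprn_ge0 ?cmod_ge0.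
have r_cvg := @remainder_cvg _ _ _ p _ _ mu _ _ _ f_an az_lt lamz_lt.
have term_le m : (2 * n <= m)%N ->
  cmod (c m * z ^+ m * (a%:C ^+ m - \sum_(k < n) mu k * lam k ^+ m))
   <= cmod (c m) * cmod (a%:C * z) ^+ m.
  move=> le_2nm; have [|v /andP[v_ge0 v_le1] ->] := t_le m; first lia.
  have -> : c m * z ^+ m * (a%:C ^+ m - a%:C ^+ m * v%:C)
      = c m * (a%:C * z) ^+ m * (1 - v)%:C.
    by rewrite rmorphB rmorph1 exprMn; ring.
  rewrite ComplexField.Normc.normcM cmod_real ComplexField.Normc.normcM cmodX.
  by rewrite ler_piMr ?mulr_ge0 ?exprn_ge0 ?cmod_ge0// ger0_norm; lra.
(* If S is infinite the bound is trivial, and the empty partial sum rules out minus infinity; only a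
   finite S = M remains. *)
case: S partial_le => [M||] partial_le; rewrite ?leey//; last first.
  by have := partial_le _ (leqnn _); rewrite big_geq.
rewrite lee_fin; apply: cmod_lim_le r_cvg _.
exists (2 * n)%N => // N /= le_2nN.
rewrite remainder_partial// (le_trans (cmod_sum_le _ _ _))//.
apply: le_trans (_ : \sum_(2 * n <= m < N) cmod (c m) * cmod (a%:C * z) ^+ m <= M).
  rewrite big_nat_cond [leRHS]big_nat_cond.
  by apply: ler_sum => m /andP[/andP[le_2nm _] _]; exact: term_le.
by rewrite -lee_fin; apply: partial_le.
Qed.

Theorem theorem5 (R : realType) (n : nat) (a p : R)
    (n_gt0 : (0 < n)%N) (a_gt0 : 0 < a) (p_gt0 : 0 < p) :
  gcheck n a p != 0 /\
  (exists lam : 'I_n -> R[i], root_list (GcheckC n a p) lam) /\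
  forall lam : 'I_n -> R[i], root_list (GcheckC n a p) lam ->
    let mu := amplitude a p lam in
    [/\ injective lam,
        forall (k : 'I_n) (z : R[i]), z != 0 ->
          (if n == 1%N then cmod (lam k * z) <= delta n a p * a * cmod z
           else cmod (lam k * z) < delta n a p * a * cmod z)
          /\ delta n a p * a * cmod z < a * cmod z,
        forall nu : 'I_n -> R[i],
          (forall m : nat, (m < n)%N ->
             \sum_(k < n) nu k * lam k ^+ m = (moment n a p m)%:C)
          <-> (forall k : 'I_n, nu k = mu k),
        forall (rho : R) (f : R[i] -> R[i]) (c : nat -> R[i]), 0 < rho ->
          analytic_in_disc rho f c ->
          forall z : R[i], cmod z < rho / a ->
            ((cmod (remainder a p lam mu f c z))%:E
              <= \sum_(2 * n <= m <oo)
                   (cmod (c m) * cmod (a%:C * z) ^+ m)%:E)%E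
      & forall q : {poly R[i]}, (size q <= 2 * n)%N ->
          forall z : R[i],
            remainder a p lam mu (fun x => q.[x]) (fun m => q`_m) z = 0].
Proof.
split; first exact: gcheck_neq0.
split; first exact: GcheckC_roots_exist.
move=> lam lamP mu.
have lam_bound (k : 'I_n) := GcheckC_root_bound k n_gt0 a_gt0 p_gt0 lamP.
have [mu_moment mu_bounded] := amplitude_quadrature n_gt0 a_gt0 p_gt0 lamP.
split.
- exact: GcheckC_roots_inj n_gt0 a_gt0 p_gt0 lamP.
- move=> k z z_neq0; have [lam_le delta_lt1] := lam_bound k.
  (* A positive modulus lets the strict inequalities survive multiplication by |z|. *)
  have z_gt0 : 0 < cmod z.
    rewrite lt_def cmod_ge0 andbT.
    by apply: contra z_neq0 => /eqP/ComplexField.Normc.eq0_normc ->.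
  split; last by rewrite ltr_pM2r// gtr_pMl.
  rewrite ComplexField.Normc.normcM; case: ifP lam_le => _.
    by rewrite ler_pM2r.
  by rewrite ltr_pM2r.
- by move=> nu; exact: amplitude_moments.
- move=> rho f c rho_gt0 f_an z z_lt.
  have az_lt : cmod (a%:C * z) < rho.
    by rewrite ComplexField.Normc.normcM cmod_real gtr0_norm// mulrC -ltr_pdivlMr.
  (* Each lambda_k z lies in the disc of convergence, since |lambda_k| <= delta a <= a and |a z| <
     rho. *)
  apply: (remainder_le n_gt0 f_an az_lt _ mu_moment mu_bounded) => k.
  apply: le_lt_trans az_lt; rewrite !ComplexField.Normc.normcM ler_wpM2r ?cmod_ge0//.
  rewrite cmod_real gtr0_norm//; have [lam_le delta_lt1] := lam_bound k.
  have lam_le_da : cmod (lam k) <= delta n a p * a.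
    by case: ifP lam_le => // _ /ltW.
  by rewrite (le_trans lam_le_da)// ger_pMl// ltW.
- by move=> q size_q z; exact: remainder_poly.
Qed.
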